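(* Let $\mathcal{S}=(\overline{x},\overline{i},\overline{c},I,T,P)$ be a safety specification. The procedure QbfWin (described in the context), run on $\mathcal{S}$, returns the winning region $W(\overline{x})$ of $\mathcal{S}$, or $\mathsf{false}$ if the specification $\mathcal{S}$ is unrealizable.
   Context: **Safety specifications.** A safety specification is a tuple $\mathcal{S}=(\overline{x},\overline{i},\overline{c},I,T,P)$ where $\overline{x},\overline{i},\overline{c}$ are finite vectors of Boolean variables (state variables, uncontrollable inputs, controllable inputs), $I(\overline{x})$ (initial states) and $P(\overline{x})$ (safe states) are propositional formulas, and $T(\overline{x},\overline{i},\overline{c},\overline{x}')$ is a propositional formula (transition relation; $\overline{x}'$ is a next-state copy of $\overline{x}$) that is complete, $\forall\overline{x},\overline{i},\overline{c}\,\exists\overline{x}'.\,T(\overline{x},\overline{i},\overline{c},\overline{x}')$, and deterministic, $\forall\overline{x},\overline{i},\overline{c},\overline{x}'_1,\overline{x}'_2.\,(T(\overline{x},\overline{i},\overline{c},\overline{x}'_1)\wedge T(\overline{x},\overline{i},\overline{c},\overline{x}'_2))\rightarrow \overline{x}'_1=\overline{x}'_2$. A state is a complete assignment to $\overline{x}$; a formula over $\overline{x}$ is identified with the set of states satisfying it. **Games.** A play is an infinite sequence of states $\mathbf{x}_0,\mathbf{x}_1,\ldots$ with $\mathbf{x}_0\models I$ such that in each step $j$ the environment first picks an assignment $\mathbf{i}_j$ to $\overline{i}$, then the system picks an assignment $\mathbf{c}_j$ to $\overline{c}$, and $\mathbf{x}_{j+1}$ is the next state given by $T$. The system wins a play iff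 all its states satisfy $P$. A (memoryless) strategy for the system is a formula $S(\overline{x},\overline{i},\overline{c},\overline{x}')$ with $S\rightarrow T$ and $\forall\overline{x},\overline{i}\,\exists\overline{c},\overline{x}'.\,S$; it is winning if all plays following $S$ instead of $T$ are won by the system. The winning region $W(\overline{x})$ is the set of all states from which a winning strategy exists (i.e., such that, if plays started in that state, the system would have a strategy winning all of them). A system implementation is a function $f$ mapping assignments of $(\overline{x},\overline{i})$ to assignments of $\overline{c}$; it realizes $\mathcal{S}$ if all plays (starting in $I$) in which the system always picks $\mathbf{c}_j=f(\mathbf{x}_j,\mathbf{i}_j)$ visit only states in $P$. $\mathcal{S}$ is realizable if some system implementation realizes it, and unrealizable otherwise. **Cubes.** A cube is a conjunction of literals, treated as a set of literals; a complete assignment to $\overline{x}$ is identified with the corresponding cube over all variables of $\overline{x}$ (minterm). **Procedure QbfWin.** All satisfiability checks are made by sound and complete oracles; whenever an oracle returns an assignment, any correct one may be returned, and the order in which literals are processed is arbitrary. 1. If $I(\overline{x})\wedge\neg P(\overline{x})$ is satisfiable, return $\mathsf{false}$. 2. Set $F(\overline{x}):=P(\overline{x})$. 3. While $\exists\overline{x},\overline{i}\,\forall\overline{c}\,\exists\overline{x}'.\;F(\overline{x})\wedge T(\overline{x},\overline{i},\overline{c},\overline{x}')\wedge\neg F(\overline{x}')$ is true, let $\mathbf{x}$ be a complete assignment to $\overline{x}$ witnessing the outermost existential quantifier, and do: (a) Set $\mathbf{x}_g:=\mathbf{x}$. For each literal $l$ of $\mathbf{x}$: set $\mathbf{x}_t:=\mathbf{x}_g\setminus\{l\}$;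 if $\exists\overline{x}\,\forall\overline{i}\,\exists\overline{c},\overline{x}'.\;\mathbf{x}_t\wedge F(\overline{x})\wedge T(\overline{x},\overline{i},\overline{c},\overline{x}')\wedge F(\overline{x}')$ is false, set $\mathbf{x}_g:=\mathbf{x}_t$. (b) If $\mathbf{x}_g\wedge I(\overline{x})$ is satisfiable, return $\mathsf{false}$. (c) Set $F(\overline{x}):=F(\overline{x})\wedge\neg\mathbf{x}_g$. 4. Return $F(\overline{x})$. *)

(* Defs.v *)
(* MathComp, plus the reflexive-transitive closure of the standard library. *)
From Stdlib Require Export Relation_Operators.
From mathcomp Require Export all_boot.

Set Implicit Arguments.
Unset Strict Implicit.
Unset Printing Implicit Defensive.

Inductive form (V : Type) : Type :=
| Fconst of bool
| Fvar of V
| Fnot of form V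
| Fand of form V & form V
| For of form V & form V.

Arguments Fconst {V} b.

Fixpoint eval (V : Type) (v : V -> bool) (A : form V) : bool :=
  match A with
  | Fconst b => b
  | Fvar k => v k
  | Fnot B => ~~ eval v B
  | Fand B C => eval v B && eval v C
  | For B C => eval v B || eval v C
  end.

Notation "v |= A" := (eval v A) (at level 70, no associativity).

Notation asg n := {ffun 'I_n -> bool}.

(* The variables of a transition relation: current state, uncontrollable
   input, controllable input, next state. *)
Inductive tvar (nx ni nc : nat) : Type :=
| Cur of 'I_nx
| Unc of 'I_ni
| Ctl of 'I_nc
| Nxt of 'I_nx.

Definition tval (nx ni nc : nat) (x : asg nx) (i : asg ni) (c : asg nc)
    (x' : asg nx) (k : tvar nx ni nc) : bool :=
  match k with
  | Cur j => x j
  | Unc j => i j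
  | Ctl j => c j
  | Nxt j => x' j
  end.

Record safety_spec (nx ni nc : nat) : Type := SafetySpec {
  init : form 'I_nx;
  trans : form (tvar nx ni nc);
  safe : form 'I_nx;
  trans_complete : forall (x : asg nx) (i : asg ni) (c : asg nc),
    exists x' : asg nx, tval x i c x' |= trans;
  trans_deterministic :
    forall (x : asg nx) (i : asg ni) (c : asg nc) (x1 x2 : asg nx),
    tval x i c x1 |= trans -> tval x i c x2 |= trans -> x1 = x2
}.

Section Games.
Variables nx ni nc : nat.
Variable S : safety_spec nx ni nc.

Implicit Types (A : asg nx -> Prop) (R : form (tvar nx ni nc)).

(* [A] is the set of states in which plays may start. *)
Definition play A R (xs : nat -> asg nx) : Prop :=
  A (xs 0) /\
  forall j, exists (i : asg ni) (c : asg nc), tval (xs j) i c (xs j.+1) |= R.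

Definition won (xs : nat -> asg nx) : Prop := forall j, xs j |= safe S.

Definition strategy R : Prop :=
  (forall (x : asg nx) (i : asg ni) (c : asg nc) (x' : asg nx),
     tval x i c x' |= R -> tval x i c x' |= trans S) /\
  (forall (x : asg nx) (i : asg ni),
     exists (c : asg nc) (x' : asg nx), tval x i c x' |= R).

Definition winning A R : Prop := forall xs, play A R xs -> won xs.

Definition winning_region (x : asg nx) : Prop :=
  exists R, strategy R /\ winning (fun y => y = x) R.

Definition realizes (f : asg nx -> asg ni -> asg nc) : Prop :=
  forall xs : nat -> asg nx,
    xs 0 |= init S ->
    (forall j, exists i : asg ni,
       tval (xs j) i (f (xs j) i) (xs j.+1) |= trans S) ->
    won xs.

Definition realizable : Prop := exists f, realizes f.

Definition unrealizable : Prop := ~ realizable.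

End Games.

(* The literal [(k, b)] is the variable [k] if [b] holds, its negation
   otherwise. *)
Notation lit n := ('I_n * bool)%type.

Definition lit_form (n : nat) (l : lit n) : form 'I_n :=
  if l.2 then Fvar l.1 else Fnot (Fvar l.1).

Definition cube_form (n : nat) (g : {set lit n}) : form 'I_n :=
  \big[@Fand 'I_n/Fconst true]_(l in g) lit_form l.

Definition minterm (n : nat) (x : asg n) : {set lit n} :=
  [set l : lit n | x l.1 == l.2].

Section QbfWin.
Variables nx ni nc : nat.
Variable S : safety_spec nx ni nc.

Implicit Types (F : form 'I_nx) (x : asg nx) (g todo : {set lit nx}).

(* [x] is in [F], and some input of the environment forces leaving [F]. *)
Definition counterexample F x : Prop :=
  exists i : asg ni, forall c : asg nc, exists x' : asg nx,
    [/\ x |= F, tval x i c x' |= trans S & ~~ (x' |= F)].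

(* Some state of [g] in [F] lets the system stay in [F] for one step. *)
Definition cube_has_safe F g : Prop :=
  exists x : asg nx, forall i : asg ni, exists (c : asg nc) (x' : asg nx),
    [/\ x |= cube_form g, x |= F, tval x i c x' |= trans S & x' |= F].

Definition satisfiable F : Prop := exists x : asg nx, x |= F.

(* In [Generalizing F todo g], [g] is the current cube and [todo] the set of
   literals of the counterexample that are still to be processed.  In
   [Returned], [None] is the answer "false". *)
Inductive config : Type :=
| Start
| Loop of form 'I_nx
| Generalizing of form 'I_nx & {set lit nx} & {set lit nx}
| Returned of option (form 'I_nx).

(* The nondeterminism of [step] is that of the oracles, which may return any
   correct assignment, and of the order in which literals are processed. *)
Inductive step : config -> config -> Prop :=
| StartUnsafe :
    satisfiable (Fand (init S) (Fnot (safe S))) ->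
    step Start (Returned None)
| StartSafe :
    ~ satisfiable (Fand (init S) (Fnot (safe S))) ->
    step Start (Loop (safe S))
| LoopBody F x :
    counterexample F x ->
    step (Loop F) (Generalizing F (minterm x) (minterm x))
| LoopExit F :
    ~ (exists x, counterexample F x) ->
    step (Loop F) (Returned (Some F))
| DropLiteral F todo g l :
    l \in todo -> ~ cube_has_safe F (g :\ l) ->
    step (Generalizing F todo g) (Generalizing F (todo :\ l) (g :\ l))
| KeepLiteral F todo g l :
    l \in todo -> cube_has_safe F (g :\ l) ->
    step (Generalizing F todo g) (Generalizing F (todo :\ l) g)
| CubeInitial F g :
    satisfiable (Fand (cube_form g) (init S)) ->
    step (Generalizing F set0 g) (Returned None)
| CubeRemoved F g :
    ~ satisfiable (Fand (cube_form g) (init S)) ->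
    step (Generalizing F set0 g) (Loop (Fand F (Fnot (cube_form g)))).

Definition reachable (s : config) : Prop := clos_refl_trans config step Start s.

(* Every run is finite and can only end by returning. *)
Definition terminates : Prop :=
  ~ (exists run : nat -> config,
       run 0 = Start /\ forall k, step (run k) (run k.+1)) /\
  (forall s, reachable s ->
     (exists r, s = Returned r) \/ (exists s', step s s')).

Definition returns (r : option (form 'I_nx)) : Prop := reachable (Returned r).

End QbfWin.

(* Main.v *)
(** Call a set of safe states controlled if from each of its states, whatever
    the input, the system can stay in the set for one step.  The loop keeps
    [F] between the initial states and the safe states, and above every
    controlled set.  The cubes removed from [F] contain no state of [F] from
    which the system can stay in [F], hence they miss every controlled set; so
    an initial state in such a cube contradicts realizability, because the
    states from which a fixed implementation wins form a controlled set.  On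
    exit [F] is itself controlled, hence the largest controlled set.  The
    procedure terminates because each cube contains the counterexample it was
    generalized from, a state of [F]. *)
From Stdlib Require Import Classical.
Require Import Defs.

Set Implicit Arguments.
Unset Strict Implicit.
Unset Printing Implicit Defensive.

(** * Formulas, cubes and infinite paths *)

Fixpoint form_map (V W : Type) (h : V -> W) (A : form V) : form W :=
  match A with
  | Fconst b => Fconst b
  | Fvar k => Fvar (h k)
  | Fnot B => Fnot (form_map h B)
  | Fand B C => Fand (form_map h B) (form_map h C)
  | For B C => For (form_map h B) (form_map h C)
  end.

Lemma eval_form_map (V W : Type) (h : V -> W) (v : W -> bool) (A : form V) :
  eval v (form_map h A) = eval (fun k => v (h k)) A.
Proof.
by elim: A => //= [B -> | B -> C -> | B -> C ->].
Qed.

Lemma eval_cube_form n (x : asg n) (g : {set lit n}) :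
  (x |= cube_form g) = [forall l in g, x l.1 == l.2].
Proof.
rewrite /cube_form (@big_morph _ _ (eval x) true andb) //.
rewrite big_andE; apply: eq_forallb => -[k b] /=.
by rewrite /lit_form /=; case: b => /=; rewrite ?eqb_id ?eqbF_neg.
Qed.

Lemma eval_minterm n (x y : asg n) : (y |= cube_form (minterm x)) = (y == x).
Proof.
rewrite eval_cube_form; apply/forall_inP/eqP => [yx | -> l]; last first.
  by rewrite inE.
by apply/ffunP => k; have := yx (k, x k); rewrite inE eqxx => /(_ isT) /eqP.
Qed.

Lemma eval_cube_form_sub n (x : asg n) (g h : {set lit n}) :
  h \subset g -> x |= cube_form g -> x |= cube_form h.
Proof.
rewrite !eval_cube_form => /subsetP hg /forall_inP xg.
by apply/forall_inP => l /hg /xg.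
Qed.

Lemma total_rel_path (V : choiceType) (e : rel V) (x : V) :
  (forall y, exists z, e y z) ->
  exists xs : nat -> V, xs 0 = x /\ forall j, e (xs j) (xs j.+1).
Proof.
move=> eT; exists (fun j => iter j (fun y => xchoose (eT y)) x); split=> // j.
by rewrite iterS; apply: (xchooseP (eT _)).
Qed.

Section Correctness.
Variables nx ni nc : nat.
Variable S : safety_spec nx ni nc.

Implicit Types (E : asg nx -> asg ni -> asg nc -> asg nx -> bool)
  (X : asg nx -> Prop) (F : form 'I_nx) (x y : asg nx) (i : asg ni)
  (c : asg nc) (s : config nx).

(** * Controlled sets, winning strategies and implementations *)

Definition follows E (xs : nat -> asg nx) : Prop :=
  forall j, exists i c, E (xs j) i c (xs j.+1).

(** A Boolean move relation [E] covers both the formula of a strategy and the graph of an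
    implementation. *)
Definition winning_from E x : Prop :=
  forall xs, xs 0 = x -> follows E xs -> won S xs.

Definition controlled X : Prop :=
  forall x, X x -> x |= safe S /\
    forall i, exists c y, tval x i c y |= trans S /\ X y.

Lemma controlled_winning_from E :
  (forall x i c y, E x i c y -> tval x i c y |= trans S) ->
  (forall x i, exists c y, E x i c y) -> controlled (winning_from E).
Proof.
move=> E_trans E_total x win_x; split=> [|i].
  (* Winning speaks only of plays, so safety of [x] needs an actual play through it; totality of [E]
     provides one. *)
  have [|xs [xs0 Exs]] :=
      @total_rel_path _ (fun y z => [exists i, [exists c, E y i c z]]) x.
    move=> y; have [c [z Ez]] := E_total y [ffun=> false].
    by exists z; apply/existsP; exists [ffun=> false]; apply/existsP; exists c.
  rewrite -xs0; apply: (win_x xs) => // j.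
  by have /existsP[i /existsP[c]] := Exs j; exists i, c.
have [c [y Ey]] := E_total x i; exists c, y; split; first exact: E_trans Ey.
(* Prepending [x] to a play from [y] gives a play from [x], which shifts positions by one. *)
move=> xs xs0 Exs j.
apply: (win_x (fun k => if k is k'.+1 then xs k' else x) _ _ j.+1) => // -[|k].
  by exists i, c; rewrite xs0.
exact: Exs.
Qed.

Lemma winning_region_controlled x :
  winning_region S x -> exists2 X, controlled X & X x.
Proof.
move=> [R [[R_trans R_total] win_x]].
exists (winning_from (fun x i c y => tval x i c y |= R)).
  exact: controlled_winning_from.
by move=> xs xs0 Rxs; apply: win_x.
Qed.

Lemma realizable_controlled :
  realizable S -> exists2 X, controlled X & forall x, x |= init S -> X x.
Proof.
move=> [f real_f].
exists (winning_from (fun x i c y => (c == f x i) && (tval x i c y |= trans S))).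
  apply: controlled_winning_from => [x i c y /andP[] // | x i].
  have [y Ty] := trans_complete S x i (f x i).
  by exists (f x i), y; rewrite eqxx.
move=> x Ix xs xs0 Exs; apply: real_f; first by rewrite xs0.
by move=> j; have [i [c /andP[/eqP-> Ty]]] := Exs j; exists i.
Qed.

Lemma controlled_winning_region F :
  controlled (fun x => x |= F) -> forall x, x |= F -> winning_region S x.
Proof.
move=> F_ctl x Fx.
pose F_cur := form_map (@Cur nx ni nc) F.
pose F_nxt := form_map (@Nxt nx ni nc) F.
(* The strategy obeys [F -> F'] on top of the transition relation; the implication leaves it total
   outside [F]. *)
exists (Fand (trans S) (For (Fnot F_cur) F_nxt)).
have evalR y i c z : (tval y i c z |= Fand (trans S) (For (Fnot F_cur) F_nxt)) =
    (tval y i c z |= trans S) && ((y |= F) ==> (z |= F)).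
  by rewrite /= !eval_form_map implybE.
split.
  split=> [y i c z | y i]; first by rewrite evalR => /andP[].
  case Fy: (y |= F).
    have [_ /(_ i) [c [z [Tz Fz]]]] := F_ctl y Fy.
    by exists c, z; rewrite evalR Tz Fz implybT.
  have [z Tz] := trans_complete S y i [ffun=> false].
  by exists [ffun=> false], z; rewrite evalR Tz Fy.
move=> xs [xs0 Rxs] j; suff /F_ctl[]: xs j |= F by [].
elim: j => [|j IHj]; first by rewrite xs0.
by have [i [c]] := Rxs j; rewrite evalR IHj => /andP[].
Qed.

Lemma controlled_realizable F :
  controlled (fun x => x |= F) -> (forall x, x |= init S -> x |= F) ->
  realizable S.
Proof.
move=> F_ctl IF.
pose stays x i c := [exists y, (tval x i c y |= trans S) && (y |= F)].
exists (fun x i => odflt [ffun=> false] [pick c | stays x i c]).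
move=> xs Ixs Txs j; suff /F_ctl[]: xs j |= F by [].
elim: j => [|j IHj]; first exact: IF.
have [i] := Txs j; case: pickP => /= [c /existsP[y /andP[Ty Fy]] Tz | no_c].
  by rewrite (trans_deterministic Tz Ty).
have [_ /(_ i) [c [y [Ty Fy]]]] := F_ctl _ IHj.
by have /existsP[] := no_c c; exists y; rewrite Ty.
Qed.

(** * Invariants of the procedure *)

Definition loop_inv F : Prop :=
  [/\ forall x, x |= init S -> x |= F,
      forall x, x |= F -> x |= safe S &
      forall X, controlled X -> forall x, X x -> x |= F].

Lemma loop_inv_controlled F :
  loop_inv F -> ~ (exists x, counterexample S F x) ->
  controlled (fun x => x |= F).
Proof.
move=> [_ FP _] no_cex x Fx; split=> [|i]; first exact: FP.
case E: [exists c, [exists y, (tval x i c y |= trans S) && (y |= F)]].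
  by have /existsP[c /existsP[y /andP[]]] := E; exists c, y.
(* If no control stays in [F], the successor that completeness gives each control lies outside
   [F]. *)
case: no_cex; exists x, i => c; have [y Ty] := trans_complete S x i c.
exists y; split=> //; apply/negP => Fy.
by have /existsP[] := E; exists c; apply/existsP; exists y; rewrite Ty.
Qed.

Lemma controlled_cube_has_safe F g X x :
  loop_inv F -> controlled X -> X x -> x |= cube_form g ->
  cube_has_safe S F g.
Proof.
move=> [_ _ XF] X_ctl Xx gx; exists x => i.
have [_ /(_ i) [c [y [Ty Xy]]]] := X_ctl x Xx.
by exists c, y; split=> //; apply: (XF X).
Qed.

(** The minterm holds at [x] alone, and by determinism a control cannot have successors both inside
    and outside [F]. *)
Lemma counterexample_no_safe F x :
  counterexample S F x -> ~ cube_has_safe S F (minterm x).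
Proof.
move=> [i cex] [y /(_ i) [c [y' []]]].
rewrite eval_minterm => /eqP-> _ Ty' Fy'.
have [z [_ Tz /negP[]]] := cex c.
by rewrite (trans_deterministic Tz Ty').
Qed.

(** While generalizing, the second conjunct makes removing the cube sound, the third makes the
    removal shrink [F]. *)
Definition config_inv s : Prop :=
  match s with
  | Start => True
  | Loop F => loop_inv F
  | Generalizing F _ g =>
      [/\ loop_inv F, ~ cube_has_safe S F g &
          exists x, x |= F /\ x |= cube_form g]
  | Returned None => unrealizable S
  | Returned (Some F) => loop_inv F /\ ~ (exists x, counterexample S F x)
  end.

Lemma step_config_inv s t : step S s t -> config_inv s -> config_inv t.
Proof.
case=> {s t} /=.
- move=> [x /= /andP[Ix nPx]] _ /realizable_controlled[X X_ctl XI].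
  by have [Px _] := X_ctl x (XI x Ix); rewrite Px in nPx.
- move=> no_bad _; split=> // [x Ix | X X_ctl x /X_ctl[]//].
  by apply/negPn/negP => nPx; case: no_bad; exists x; rewrite /= Ix.
- move=> F x cex F_inv; split=> //; first exact: counterexample_no_safe.
  exists x; rewrite eval_minterm; split=> //.
  have [i /(_ [ffun=> false]) [y []]] := cex; done.
- by [].
- move=> F todo g l _ no_safe [F_inv _ [x [Fx gx]]]; split=> //.
  (* Dropping a literal only enlarges the cube, so it keeps [x]. *)
  by exists x; split=> //; apply: eval_cube_form_sub gx; apply: subsetDl.
- by [].
- move=> F g [x /= /andP[gx Ix]] [F_inv no_safe _].
  move=> /realizable_controlled[X X_ctl XI]; apply: no_safe.
  exact: controlled_cube_has_safe (XI x Ix) gx.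
- move=> F g no_init [F_inv no_safe _]; have [IF FP XF] := F_inv.
  split=> [x Ix | x /andP[/FP] // | X X_ctl x Xx] /=.
    by rewrite IF //=; apply/negP => gx; case: no_init; exists x; rewrite /= gx.
  rewrite (XF X) //=; apply/negP => gx; apply: no_safe.
  exact: controlled_cube_has_safe Xx gx.
Qed.

Lemma reachable_config_inv s : reachable S s -> config_inv s.
Proof.
rewrite /reachable; have: config_inv (@Start nx) by [].
move: (@Start nx) => s0 s0_inv run; elim: run s0_inv => //.
  by move=> *; apply: step_config_inv; eassumption.
by auto.
Qed.

(** * Termination and progress *)

(* While generalizing, the predecessor pays in advance for the state that
   [CubeRemoved] will take out of [F]. *)
Definition config_measure s : nat :=
  let N := #|{: lit nx}|.+2 in
  match s with
  | Start => #|{: asg nx}| * N + 2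
  | Loop F => #|[pred x : asg nx | x |= F]| * N + 1
  | Generalizing F todo _ => #|[pred x : asg nx | x |= F]|.-1 * N + #|todo| + 2
  | Returned _ => 0
  end.

Lemma step_config_measure s t :
  step S s t -> config_inv s -> config_measure t < config_measure s.
Proof.
case=> {s t} /=.
- by move=> *; rewrite addn2.
- by move=> _ _; rewrite addn2 addn1 !ltnS leq_mul2r max_card orbT.
- move=> F x [i /(_ [ffun=> false]) [y [Fx _ _]]] _.
  (* Since [F] has a state, one block of [N] is released; it pays for all literals of the minterm
     and the larger offset. *)
  have: 0 < #|[pred x : asg nx | x |= F]| by apply/card_gt0P; exists x.
  case: #|_| => //= m _.
  by rewrite mulSn addn1 ltnS -addnA addnC leq_add2r addn2 !ltnS max_card.
- by move=> *; rewrite addn1.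
- move=> F todo g l l_todo _ _.
  by rewrite ltn_add2r ltn_add2l [X in _ < X](cardsD1 l) l_todo.
- move=> F todo g l l_todo _ _.
  by rewrite ltn_add2r ltn_add2l [X in _ < X](cardsD1 l) l_todo.
- by move=> *; rewrite addn2.
- move=> F g _ [_ _ [x [Fx gx]]].
  rewrite cards0 addn0 addn1 addn2 !ltnS leq_mul2r /=.
  rewrite -ltnS prednK; last by apply/card_gt0P; exists x.
  apply/proper_card/properP; split; last by exists x; rewrite // inE /= gx andbF.
  by apply/subsetP => y /andP[].
Qed.

Lemma no_infinite_run (run : nat -> config nx) :
  run 0 = Start nx -> (forall k, step S (run k) (run k.+1)) -> False.
Proof.
move=> run0 runS.
have run_inv k : config_inv (run k).
  by elim: k => [|k]; [rewrite run0 | apply: step_config_inv].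
(* Every step costs at least one unit, which fails at the index one past the initial measure. *)
have run_le k : config_measure (run k) + k <= config_measure (run 0).
  elim: k => [|k IHk]; first by rewrite addn0.
  apply: leq_trans IHk; rewrite addnS -addSn leq_add2r.
  exact: step_config_measure.
have := leq_trans (leq_addl _ _) (run_le (config_measure (run 0)).+1).
by rewrite ltnn.
Qed.

(** The oracle tests are propositions; excluded middle selects the rule that applies. *)
Lemma step_progress s : (exists r, s = Returned r) \/ (exists t, step S s t).
Proof.
case: s => [|F|F todo g|r]; last by left; exists r.
- by right; case: (classic (satisfiable (Fand (init S) (Fnot (safe S)))));
    eexists; constructor.
- right; case: (classic (exists x, counterexample S F x)) => [[x cex] | no_cex].
    by eexists; apply: LoopBody cex.
  by eexists; apply: LoopExit.
right; have [-> | [l l_todo]] := set_0Vmem todo.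
  by case: (classic (satisfiable (Fand (cube_form g) (init S))));
    eexists; [apply: CubeInitial | apply: CubeRemoved].
case: (classic (cube_has_safe S F (g :\ l))) => safe_g; eexists.
  exact: KeepLiteral safe_g.
exact: DropLiteral safe_g.
Qed.

End Correctness.

Theorem theorem6 (nx ni nc : nat) (S : safety_spec nx ni nc) :
  terminates S /\
  forall r : option (form 'I_nx), returns S r ->
    (unrealizable S /\ r = None) \/
    (realizable S /\
     exists F : form 'I_nx, r = Some F /\
       forall x : asg nx, x |= F <-> winning_region S x).
Proof.
split.
  split=> [[run [run0 runS]] | s _]; last exact: step_progress.
  exact: no_infinite_run run0 runS.
move=> [F|] /reachable_config_inv /=; last by left.
move=> [F_inv no_cex]; right.
have F_ctl := loop_inv_controlled F_inv no_cex; have [IF _ XF] := F_inv.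
split; first exact: controlled_realizable F_ctl IF.
exists F; split=> // x; split; first exact: controlled_winning_region.
by case/winning_region_controlled => X /XF; apply.
Qed.
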